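(* Let $\mathcal H$ be a separable real Hilbert space, $\mathbf A,\mathbf B\in\mathcal B_1^+(\mathcal H)$, and let $\mathbf G\in\mathcal G(\mathbf A)$, $\mathbf M\in\mathcal G(\mathbf B)$ with $\mathbf G^*\mathbf M\succeq\mathbf 0$. Let $\phi,\psi:\mathcal H\to[0,+\infty]$ be the associated functions (see context). Then $\phi$ (resp. $\psi$) is convex, and its subdifferential at $x\in\mathcal H$ (resp. $y\in\mathcal H$) satisfies $\partial\phi(x)\supset\mathcal S_{\mathbf M}(x)$ (resp. $\partial\psi(y)\supset\mathcal S_{\mathbf G}(y)$).
   Context: $\mathcal B_1^+(\mathcal H)$ is the set of self-adjoint positive semidefinite trace-class operators. $\mathcal G(\mathbf A)$ is the set of compact operators $\mathbf G$ on $\mathcal H$ with $\mathbf G\mathbf G^*=\mathbf A$. $\mathbf C\succeq\mathbf 0$ means self-adjoint positive semidefinite. Let $\mathcal S:=\overline{\{(\mathbf Gz,\mathbf Mz):z\in\mathcal H\}}$, closure in $\mathcal H\times\mathcal H$, and let $\mathcal S_{\mathbf M}(x):=\{y\in\mathcal H:(x,y)\in\mathcal S\}$, $\mathcal S_{\mathbf G}(y):=\{x\in\mathcal H:(x,y)\in\mathcal S\}$. Define $$\phi(x)=\begin{cases}\langle x,y\rangle/2\ \text{ for any } y\in\mathcal S_{\mathbf M}(x),&\mathcal S_{\mathbf M}(x)\ne\emptyset,\\+\infty,&\mathcal S_{\mathbf M}(x)=\emptyset,\end{cases}\qquad\psi(y)=\begin{cases}\langle x,y\rangle/2\ \text{ for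 any } x\in\mathcal S_{\mathbf G}(y),&\mathcal S_{\mathbf G}(y)\ne\emptyset,\\+\infty,&\mathcal S_{\mathbf G}(y)=\emptyset.\end{cases}$$ These are well defined: $y\mapsto\langle x,y\rangle$ is constant on $\mathcal S_{\mathbf M}(x)$, and symmetrically for $\mathcal S_{\mathbf G}(y)$. The subdifferential is $\partial\phi(x)=\{y:\phi(x+\delta)\ge\phi(x)+\langle y,\delta\rangle\ \forall\delta\in\mathcal H\}$. *)

(* Defs.v *)
From HB Require Import structures.
From mathcomp Require Import all_boot all_order all_algebra.
From mathcomp Require Import all_classical all_reals all_analysis.

Set Implicit Arguments.
Unset Strict Implicit.
Unset Printing Implicit Defensive.

Import Order.TTheory GRing.Theory Num.Theory.
Import numFieldNormedType.Exports.

Local Open Scope classical_set_scope.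
Local Open Scope ring_scope.

(* A real Hilbert space is a complete normed module [H] over [R : realType]
   together with an inner product [dot : {dot H for idfun}] inducing its norm. *)
Definition induces_norm (R : realType) (H : completeNormedModType R)
    (dot : {dot H for idfun}) : Prop :=
  forall x : H, `|x| ^+ 2 = dot x x.

Definition separable (T : topologicalType) : Prop :=
  exists2 D : set T, countable D & dense D.

Section Operators.
Context {R : realType} {H : completeNormedModType R}.
Variable dot : {dot H for idfun}.
Implicit Types (T G M A P : {linear H -> H}).

(* The vector representing [fun x => dot (T x) y]; for a bounded linear [T] it
   exists and is unique by the Riesz representation theorem. *)
Definition adjoint (T : H -> H) (y : H) : H :=
  xget 0 [set z | forall x, dot (T x) y = dot x z].

Definition self_adjoint (T : H -> H) : Prop :=
  forall x y, dot (T x) y = dot x (T y).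

Definition psd (T : H -> H) : Prop :=
  self_adjoint T /\ forall x, 0 <= dot (T x) x.

Definition compact_op T : Prop :=
  compact (closure (T @` [set x | `|x| <= 1])).

Definition orthonormal_basis (E : set H) : Prop :=
  (forall e f, E e -> E f -> dot e f = (e == f)%:R) /\
  (forall x, (forall e, E e -> dot x e = 0) -> x = 0).

(* [P] is the operator |T| = (T^* T)^(1/2). *)
Definition is_abs T P : Prop :=
  [/\ continuous P, psd P & forall x, P (P x) = adjoint T (T x)].

Definition trace_class T : Prop :=
  continuous T /\
  exists P E, [/\ is_abs T P, orthonormal_basis E &
    (\esum_(e in E) (dot (P e) e)%:E < +oo)%E].

Definition B1plus : set {linear H -> H} :=
  [set A | trace_class A /\ psd A].

Definition square_roots A : set {linear H -> H} :=
  [set G | compact_op G /\ forall x, G (adjoint G x) = A x].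

Definition graph_closure G M : set (H * H) :=
  closure [set (G z, M z) | z in [set: H]].

Definition S_M G M (x : H) : set H := [set y | graph_closure G M (x, y)].

Definition S_G G M (y : H) : set H := [set x | graph_closure G M (x, y)].

(* When [adjoint G \o M] is positive semidefinite, [dot x] is constant on
   [S_M G M x], so the value does not depend on the element that [xget] picks;
   likewise for [psi]. *)
Definition phi G M (x : H) : \bar R :=
  if pselect (S_M G M x !=set0)
  then (dot x (xget 0 (S_M G M x)) / 2)%:E else +oo%E.

Definition psi G M (y : H) : \bar R :=
  if pselect (S_G G M y !=set0)
  then (dot (xget 0 (S_G G M y)) y / 2)%:E else +oo%E.

Definition subdifferential (f : H -> \bar R) (x : H) : set H :=
  [set y | forall delta, (f x + (dot y delta)%:E <= f (x + delta)%R)%E].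

End Operators.

(* For functions into (-oo, +oo]; at the endpoints of [0, 1] the convention
   0 * +oo = 0 makes the inequality trivial. *)
Definition convex_efun (R : realType) (H : lmodType R) (f : H -> \bar R) : Prop :=
  forall (x y : H) (t : R), 0 <= t <= 1 ->
    (f (t *: x + (1 - t) *: y)%R <= t%:E * f x + (1 - t)%:E * f y)%E.

(* Main.v *)
(* The graph {(G z, M z)} is a monotone subspace on which (p, q) |-> <p.1, q.2>
   is symmetric, because G^* M is positive semidefinite; both properties pass to
   the closure S by continuity. On S the form <p.1, p.2> is therefore a
   nonnegative quadratic form: its nonnegativity at p - q gives the convexity of
   phi along segments in its domain, and, combined with symmetry, the
   subgradient inequality. The transpose of S has the same properties, which
   handles psi. *)
Require Import Defs.
From HB Require Import structures.
From mathcomp Require Import all_boot all_order all_algebra.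
From mathcomp Require Import all_classical all_reals all_analysis.
From mathcomp Require Import ring lra.

Set Implicit Arguments.
Unset Strict Implicit.
Unset Printing Implicit Defensive.

Import Order.TTheory GRing.Theory Num.Theory.
Import numFieldNormedType.Exports.

Local Open Scope classical_set_scope.
Local Open Scope ring_scope.

(** * Inner-product calculus, Riesz representation and adjoints *)

Section InnerProduct.
Context {R : realType} {H : completeNormedModType R}.
Variable dot : {dot H for idfun}.
Hypothesis dot_norm : induces_norm dot.

Lemma dotC x y : dot x y = dot y x.
Proof. by rewrite hermC expr0 mul1r. Qed.

Lemma dotDl x y z : dot (x + y) z = dot x z + dot y z.
Proof. exact: linearDl. Qed.

Lemma dotDr x y z : dot z (x + y) = dot z x + dot z y.
Proof. exact: linearDr. Qed.

Lemma dotZl a x z : dot (a *: x) z = a * dot x z.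
Proof. exact: linearZl_LR. Qed.

Lemma dotZr a x z : dot z (a *: x) = a * dot z x.
Proof. by rewrite dotC dotZl dotC. Qed.

Lemma dotNl x z : dot (- x) z = - dot x z.
Proof. exact: linearNl. Qed.

Lemma dotNr x z : dot z (- x) = - dot z x.
Proof. exact: linearNr. Qed.

Definition dotE := (dotDl, dotDr, dotZl, dotZr, dotNl, dotNr).

Lemma polarization x y : dot x y = (`|x + y| ^+ 2 - `|x - y| ^+ 2) / 4.
Proof. by rewrite !dot_norm !dotE (dotC y x); field. Qed.

(** Polarization reduces the claim to continuity of the norm. *)
Lemma continuous_dot (T : topologicalType) (f g : T -> H) :
  continuous f -> continuous g -> continuous (fun t => dot (f t) (g t)).
Proof.
move=> cf cg t.
have -> : (fun t => dot (f t) (g t)) =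
    (fun t => (`|f t + g t| * `|f t + g t| - `|f t - g t| * `|f t - g t|) / 4).
  by apply/funext => s; rewrite polarization !expr2.
apply: cvgM; last exact: cvg_cst.
have cN : `|f x + g x| @[x --> t] --> `|f t + g t|.
  by apply: cvg_norm; apply: cvgD; [exact: cf|exact: cg].
have cB : `|f x - g x| @[x --> t] --> `|f t - g t|.
  by apply: cvg_norm; apply: cvgB; [exact: cf|exact: cg].
by apply: cvgB; apply: cvgM.
Qed.

(* The representing vector is the minimizer of [|x|^2 - 2 f x]; minimizing
   sequences are Cauchy by the parallelogram law. *)
Lemma riesz_representation (f : {linear H -> R^o}) : continuous f ->
  exists z, forall x, f x = dot x z.
Proof.
move=> cf.
have [C fC] : exists C, forall x, `|f x| <= C * `|x|.
  have /linear_boundedP : bounded_near f (nbhs (0 : H)).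
    exact/linear_bounded_continuous.
  by move=> [M [_ MP]]; exists (M + 1) => x; apply: MP; rewrite ltrDl.
pose J x := dot x x - 2 * f x.
(* Complete the square in [|x|^2 - 2 C |x|]. *)
have J_lb x : - C ^+ 2 <= J x.
  have := fC x; rewrite ler_norml => /andP[_ fx].
  rewrite /J -dot_norm; have := sqr_ge0 (`|x| - C); nra.
(* The linear terms in [f] cancel. *)
have J_par x y : dot (x - y) (x - y) = 2 * J x + 2 * J y - 4 * J (2^-1 *: (x + y)).
  by rewrite /J !linearZ !linearD /= !dotE (dotC y x) /GRing.scale /=; field.
have has_J : has_inf (range J).
  by split; [exists (J 0), 0|exists (- C ^+ 2) => _ [x _ <-]].
pose m := inf (range J).
have m_le x : m <= J x by apply: ge_inf; [case: has_J|exists x].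
(* The strict sublevel sets of [J] above its infimum play the role of a minimizing sequence. *)
pose F : set_system H :=
  filter_from [set e : R | 0 < e] (fun e => [set x | J x < m + e]).
have FF : ProperFilter F.
  apply: filter_from_proper; last first.
    by move=> e e0; have [_ [x _ <-] Jx] := inf_adherent e0 has_J; exists x.
  apply: filter_from_filter; first by exists 1 => /=.
  move=> e1 e2 /= e10 e20; exists (Num.min e1 e2); first by rewrite /= lt_min e10.
  by move=> x /=; rewrite addr_minr lt_min => /andP[].
have F_cvg : cvg F.
  apply: cauchy_cvg; apply: cauchy_exP => e e0.
  (* If [J x] and [J y] are below [m + e^2/4], then [J_par] and [m <= J] at the midpoint give
     [|x - y|^2 < e^2]. *)
  have d0 : 0 < e ^+ 2 / 4 by rewrite divr_gt0 // exprn_gt0.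
  have [_ [x _ <-] Jx] := inf_adherent d0 has_J.
  exists x; exists (e ^+ 2 / 4) => // y /= Jy.
  rewrite -ball_normE /ball_ /=.
  rewrite -(@ltr_pXn2r _ 2) ?nnegrE ?(ltW e0) // dot_norm J_par.
  have := m_le (2^-1 *: (x + y)); rewrite -/m in Jx; lra.
have cJ : continuous J.
  move=> x; apply: cvgB; first exact: (continuous_dot (fun=> cvg_id) (fun=> cvg_id)).
  by apply: cvgM; [exact: cvg_cst|exact: cf].
pose z := lim F.
have Jz x : J z <= J x.
  apply: le_trans (m_le x); apply/ler_addgt0Pr => e e0.
  have JF : J @ F --> J z by move=> A /cJ; exact: F_cvg.
  apply: (cvgr_to_le JF); exists e => // y /= Jy; exact: ltW.
exists z => x.
have quad t : 0 <= t ^+ 2 * dot x x + 2 * t * (dot x z - f x).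
  have fD : f (z + t *: x) = f z + t * f x by rewrite linearD linearZ.
  by have := Jz (z + t *: x); rewrite /J fD !dotE (dotC z x); nra.
have [x0|xN0] := eqVneq (dot x x) 0.
  by have := quad 1; have := quad (-1); rewrite x0; lra.
have xx0 : 0 < dot x x by rewrite lt_neqAle eq_sym xN0 -dot_norm sqr_ge0.
(* This [t] minimizes the quadratic in [quad]; its minimum [- d^2 / dot x x] must be nonnegative,
   which forces [d = 0]. *)
have := quad (- (dot x z - f x) / dot x x).
set d := dot x z - f x => hd.
have : d ^+ 2 <= 0.
  move: hd.
  have -> : (- d / dot x x) ^+ 2 * dot x x + 2 * (- d / dot x x) * d = - (d ^+ 2 / dot x x) by field.
  by rewrite oppr_ge0 pmulr_lle0 // invr_gt0.
by rewrite le_eqVlt ltNge sqr_ge0 orbF sqrf_eq0 subr_eq0 => /eqP.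
Qed.

Definition dot_comp (T : H -> H) (y x : H) : R^o := dot (T x) y.

Lemma dot_comp_is_linear (T : {linear H -> H}) y : linear (dot_comp T y).
Proof. by move=> a u v; rewrite /dot_comp linearP dotDl dotZl. Qed.

HB.instance Definition _ (T : {linear H -> H}) y :=
  GRing.isLinear.Build R H R^o _ (dot_comp T y) (dot_comp_is_linear T y).

(** Riesz supplies a representing vector, so the [xget] in [adjoint] does not fall back on its
    default 0. *)
Lemma adjointP (T : {linear H -> H}) : continuous T ->
  forall x y, dot (T x) y = dot x (adjoint dot T y).
Proof.
move=> cT x y.
have [z zP] : exists z, forall x, dot_comp T y x = dot x z.
  apply: (@riesz_representation (dot_comp T y)).
  exact: (continuous_dot cT (fun=> cvg_cst _)).
by apply: (@xgetPex _ 0 [set z | forall x, dot (T x) y = dot x z]); exists z.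
Qed.

(** A compact set is bounded, so [T] is bounded on the unit ball. *)
Lemma compact_op_continuous (T : {linear H -> H}) : compact_op T -> continuous T.
Proof.
move=> /compact_bounded[C [_ CP]].
apply/linear_bounded_continuous/ex_bound; exists (C + 1).
have TC x : `|x| <= 1 -> `|T x| <= C + 1.
  move=> x1; apply: (CP (C + 1)); first by rewrite ltrDl.
  by apply: subset_closure; exists x.
rewrite nbhs_ballP /=; exists 1 => //= x; rewrite -ball_normE /ball_ /= sub0r normrN.
by move=> /ltW /TC.
Qed.

(** * Convexity and subgradients of the energy of a monotone symmetric subspace *)

Section MonotoneSubspace.
Variable S : set (H * H).
Hypothesis S_linear : forall a b p q, S p -> S q -> S (a *: p + b *: q).
Hypothesis S_sym : forall p q, S p -> S q -> dot p.1 q.2 = dot q.1 p.2.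
Hypothesis S_ge0 : forall p, S p -> 0 <= dot p.1 p.2.

(* [phi] is the energy of the closed graph and [psi] that of its transpose. *)
Definition energy (x : H) : \bar R :=
  if pselect ([set y | S (x, y)] !=set0)
  then (dot x (xget 0 [set y | S (x, y)]) / 2)%:E else +oo%E.

(** Symmetry applied to two pairs with the same first component [x] shows that the chosen witness is
    irrelevant. *)
Lemma energyE x y : S (x, y) -> energy x = (dot x y / 2)%:E.
Proof.
move=> Sxy; rewrite /energy; case: pselect => [S0|[]] /=; last by exists y.
have Sx : S (x, xget 0 [set y | S (x, y)]).
  by apply: (@xgetPex _ 0 [set y | S (x, y)]); exists y.
by rewrite (S_sym Sx Sxy).
Qed.

Variant energy_spec x : \bar R -> Prop :=
| EnergyFin y of S (x, y) : energy_spec x (dot x y / 2)%:E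
| EnergyInfty : energy_spec x +oo%E.

Lemma energyP x : energy_spec x (energy x).
Proof.
have [[y Sxy]|S0] := pselect ([set y | S (x, y)] !=set0).
  by rewrite (energyE Sxy); exact: EnergyFin.
by rewrite /energy; case: pselect => // S1; exact: EnergyInfty.
Qed.

Lemma monotone_subspace x y x' y' : S (x, y) -> S (x', y') ->
  dot x y' + dot x' y <= dot x y + dot x' y'.
Proof.
move=> Sp Sq; have := S_ge0 (S_linear 1 (-1) Sp Sq).
by rewrite /= !dotE; lra.
Qed.

Lemma energy_convex : convex_efun energy.
Proof.
move=> x x' t /andP[t0 t1].
(* The endpoints are split off because [t * +oo] is [+oo] only for positive [t]. *)
have [->|tN0] := eqVneq t 0.
  by rewrite scale0r add0r subr0 scale1r mul0e add0e mul1e.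
have [->|tN1] := eqVneq t 1.
  by rewrite subrr scale0r addr0 scale1r mul0e adde0 mul1e.
have tgt0 : 0 < t by rewrite lt_neqAle eq_sym tN0.
have tlt1 : 0 < 1 - t by rewrite subr_gt0 lt_neqAle tN1.
case: (energyP x) => [y Sp|]; last first.
  rewrite mulry gtr0_sg // mul1e.
  case: (energyP x') => [y' _|]; first by rewrite -EFinM addye ?leey.
  by rewrite mulry gtr0_sg // mul1e leey.
case: (energyP x') => [y' Sq|]; last first.
  by rewrite mulry gtr0_sg // mul1e -EFinM addey ?leey.
rewrite (energyE (S_linear t (1 - t) Sp Sq)) -!EFinM -EFinD lee_fin !dotE.
(* The convexity gap equals [t (1 - t) / 2] times [dot (x - x') (y - y')]. *)
have := ler_wpM2l (mulr_ge0 (ltW tgt0) (ltW tlt1)) (monotone_subspace Sp Sq).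
lra.
Qed.

Lemma energy_subdifferential x y : S (x, y) -> subdifferential dot energy x y.
Proof.
move=> Sp d; rewrite (energyE Sp).
case: (energyP (x + d)) => [y' Sq|]; last by rewrite leey.
(* Symmetry turns [dot x y'] into [dot (x + d) y], so monotonicity reads [2 dot (x + d) y <= dot x y
   + dot (x + d) y']. *)
have := monotone_subspace Sp Sq.
have := S_sym Sp Sq => /=.
by rewrite -EFinD lee_fin !dotE (dotC y d); lra.
Qed.

End MonotoneSubspace.

(** * Linearity, symmetry and positivity of the closed graph *)

Section GraphClosure.
Variables G M : {linear H -> H}.
Hypothesis cG : continuous G.
Hypothesis GM_psd : psd dot (adjoint dot G \o M).

Lemma graph_closure_ind (P : set (H * H)) :
  closed P -> (forall z, P (G z, M z)) -> graph_closure G M `<=` P.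
Proof.
move=> clP PG; rewrite /graph_closure closureE; apply: smallest_sub => //.
by move=> _ [z _ <-].
Qed.

Lemma graph_closureP z : graph_closure G M (G z, M z).
Proof. by apply: subset_closure; exists z. Qed.

Lemma graph_closure_linear a b p q :
  graph_closure G M p -> graph_closure G M q ->
  graph_closure G M (a *: p + b *: q).
Proof.
have lin_closed (v : H * H) (c : R) :
    closed [set r | graph_closure G M (c *: r + v)].
  have /continuous_closedP : continuous (fun r : H * H => c *: r + v).
    by move=> r; apply: cvgD; [apply: cvgZr; exact: cvg_id|exact: cvg_cst].
  by apply; exact: closed_closure.
(* Closure induction runs on one argument at a time, the other being frozen. *)
move=> + Sq; move: p; apply: (graph_closure_ind (lin_closed (b *: q) a)) => z /=.
rewrite addrC; move: q Sq.
apply: (graph_closure_ind (lin_closed (a *: (G z, M z)) b)) => w /=.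
have e (T : {linear H -> H}) : T (b *: w + a *: z) = b *: T w + a *: T z by rewrite linearD !linearZ.
have h := @graph_closureP (b *: w + a *: z); rewrite (e G) (e M) in h.
exact h.
Qed.

Lemma graph_closure_sym p q :
  graph_closure G M p -> graph_closure G M q -> dot p.1 q.2 = dot q.1 p.2.
Proof.
have sym_closed (r : H * H) : closed [set s : H * H | dot s.1 r.2 = dot r.1 s.2].
  have -> : [set s : H * H | dot s.1 r.2 = dot r.1 s.2] =
      (fun s => dot s.1 r.2 - dot r.1 s.2) @^-1` [set 0].
    by apply/seteqP; split => s /=; [move->; rewrite subrr|move=> /subr0_eq].
  have /continuous_closedP : continuous (fun s : H * H => dot s.1 r.2 - dot r.1 s.2).
    move=> s; apply: cvgB.
      exact: (continuous_dot (fun=> cvg_fst) (fun=> cvg_cst _)).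
    exact: (continuous_dot (fun=> cvg_cst _) (fun=> cvg_snd)).
  by apply; exact: closed_eq.
move=> + Sq; move: p; apply: (graph_closure_ind (sym_closed q)) => z /=.
apply/esym; move: q Sq; apply: (graph_closure_ind (sym_closed (G z, M z))) => w /=.
rewrite !(adjointP cG) dotC; exact: GM_psd.1.
Qed.

Lemma graph_closure_ge0 p : graph_closure G M p -> 0 <= dot p.1 p.2.
Proof.
move: p; apply: (@graph_closure_ind (fun p => 0 <= dot p.1 p.2)) => [|z] /=.
  have /continuous_closedP : continuous (fun s : H * H => dot s.1 s.2).
    exact: (continuous_dot (fun=> cvg_fst) (fun=> cvg_snd)).
  by move=> /(_ [set x | 0 <= x]); apply; exact: closed_ge.
by rewrite (adjointP cG) dotC; exact: GM_psd.2.
Qed.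

End GraphClosure.

End InnerProduct.

Theorem proposition6p14 (R : realType) (H : completeNormedModType R)
    (dot : {dot H for idfun}) (dot_norm : induces_norm dot)
    (H_separable : separable H)
    (A B : {linear H -> H}) (hA : B1plus dot A) (hB : B1plus dot B)
    (G M : {linear H -> H})
    (hG : square_roots dot A G) (hM : square_roots dot B M)
    (hGM : psd dot (adjoint dot G \o M)) :
  (convex_efun (phi dot G M) /\
   forall x : H, S_M G M x `<=` subdifferential dot (phi dot G M) x) /\
  (convex_efun (psi dot G M) /\
   forall y : H, S_G G M y `<=` subdifferential dot (psi dot G M) y).
Proof.
have cG : continuous G by apply: compact_op_continuous; exact: hG.1.
have S_lin := @graph_closure_linear _ _ G M.
have S_sym := graph_closure_sym dot_norm cG hGM.
have S_ge0 := graph_closure_ge0 dot_norm cG hGM.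
split; split.
(* [phi] is convertible to the energy of the closed graph. *)
- exact: (energy_convex S_lin S_sym S_ge0).
- by move=> x y; exact: (energy_subdifferential S_lin S_sym S_ge0).
all: pose S' := [set p | graph_closure G M (p.2, p.1)].
all: have S'_lin a b p q : S' p -> S' q -> S' (a *: p + b *: q) by exact: S_lin.
all: have S'_sym p q : S' p -> S' q -> dot p.1 q.2 = dot q.1 p.2
  by move=> Sp Sq; rewrite dotC (S_sym _ _ Sq Sp) dotC.
all: have S'_ge0 p : S' p -> 0 <= dot p.1 p.2 by rewrite dotC; exact: S_ge0.
(* [psi] pairs its arguments in the opposite order, so it matches the energy of the transpose only
   up to [dotC]. *)
all: have -> : psi dot G M = energy dot S'
  by apply/funext => y; rewrite /psi /energy dotC.
- exact: (energy_convex S'_lin S'_sym S'_ge0).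
- by move=> y x; exact: (energy_subdifferential S'_lin S'_sym S'_ge0).
Qed.
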